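(* For each integer $n\ge2$ let $\mathbf D^{(n)}=\{d^{(n)}_1<\dots<d^{(n)}_{n+1}\}$ be an ordered finite subset of $\mathbb R$ with $n+1$ elements, and let $X^{(n)}:\Omega\to\mathbf D^{(n)}$ be a random variable on a probability space $(\Omega,\mathcal F,\mathbb P)$ with probability mass function $\mathbb P(X^{(n)}=d^{(n)}_j)=\mathcal T^{(1)}_{n,j}$ for $1\le j\le n+1$. Put $\mathcal I_{|\mathbf D^{(n)}|}=\{2,\dots,|\mathbf D^{(n)}|-1\}$. Then: (1) $X^{(2)},X^{(3)},X^{(4)}$ are log-concave random variables, with $\mathcal I^{(0)}_{|\mathbf D^{(n)}|}=\mathcal I_{|\mathbf D^{(n)}|}$ for $n=2,3,4$; (2) for every $n\ge5$, $X^{(n)}$ is a near-log-concave random variable of degree $1$ with $\mathcal I^{(1)}_{|\mathbf D^{(n)}|}=\mathcal I_{|\mathbf D^{(n)}|}\setminus\{4\}$.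
   Context: Define $\psi:\{1,2,3,\dots\}\to\{0,1,2,\dots\}$ by $\psi(1)=0$, $\psi(2)=1$, $\psi(3)=2$ and $\psi(j)=\sum_{k=1}^{j-1}\psi(k)$ for $j\ge 4$. The triangular array $\mathcal T=(\mathcal T_{n,j})$, $n\ge 0$, $1\le j\le n+1$, of integers is defined recursively by: $\mathcal T_{n,n+1}=1$ for every $n\ge 0$; $\mathcal T_{1,1}=1$, $\mathcal T_{2,2}=2$, $\mathcal T_{3,3}=3$; $\mathcal T_{n,n}=\sum_{k=1}^{n-2}\mathcal T_{n-k,n-k}$ for every $n\ge 4$; and $\mathcal T_{n,j}=\mathcal T_{n-1,j}+\psi(j)$ for every $n\ge 2$ and $1\le j\le n-1$. The normalised array is $\mathcal T^{(1)}_{n,j}=2^{-n}\mathcal T_{n,j}$; each of its rows is a probability mass function. Near-log-concave random variables: let $\mathbf D=\{d_1<\dots<d_{|\mathbf D|}\}\subset\mathbb R$ be finite with $|\mathbf D|\ge3$ and $X$ a $\mathbf D$-valued random variable with mass function $P_X(d_j)=\mathbb P(X=d_j)$. $X$ is near-log-concave of degree $r$ (integer, $0\le r\le|\mathbf D|-3$) with index set $\mathcal I^{(r)}_{|\mathbf D|}$ if $\mathcal I^{(r)}_{|\mathbf D|}\subseteq\{2,\dots,|\mathbf D|-1\}$, $|\mathcal I^{(r)}_{|\mathbf D|}|=|\mathbf D|-r-2$, and $P_X(d_{j-1})P_X(d_{j+1})\le P_X(d_j)^2$ for all $j\in\mathcal I^{(r)}_{|\mathbf D|}$. Log-concave means near-log-concave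 of degree $0$. *)

(* Defs.v *)
From HB Require Import structures.
From mathcomp Require Import all_boot all_order all_algebra finmap.
From mathcomp Require Import all_classical all_reals all_analysis.

Set Implicit Arguments.
Unset Strict Implicit.
Unset Printing Implicit Defensive.

Import Order.TTheory GRing.Theory Num.Theory.

Local Open Scope ring_scope.

(* Course-of-values recursion: [cov F] is the function f with f n = F n f,
   provided that F n only uses the values of f below n (lemma [covE]). *)
Fixpoint history (F : nat -> (nat -> nat) -> nat) (n : nat) : seq nat :=
  if n is m.+1 then
    let s := history F m in rcons s (F m (fun i => nth 0%N s i))
  else [::].

Definition cov (F : nat -> (nat -> nat) -> nat) (n : nat) : nat :=
  nth 0%N (history F n.+1) n.

(* psi 0 is a junk value. *)
Definition psi : nat -> nat := cov (fun j f =>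
  match j with
  | 0 => 0
  | 1 => 0
  | 2 => 1
  | 3 => 2
  | _ => \sum_(1 <= k < j) f k
  end)%N.

(* The entries T_{n,n}; the value at 0 is junk. *)
Definition Tdiag : nat -> nat := cov (fun n f =>
  match n with
  | 0 => 0
  | 1 => 1
  | 2 => 2
  | 3 => 3
  | _ => \sum_(1 <= k < n.-1) f (n - k)
  end)%N.

(* T_{n,j} for 1 <= j <= n+1; 0 for other j. The defining recursion is
   recovered by [calT_last], [calT11], [calT22], [calT33], [calT_diag] and
   [calT_step]. *)
Fixpoint calT (n j : nat) : nat :=
  if j == n.+1 then 1%N
  else if n is m.+1 then
    if j == n then Tdiag n
    else if (1 <= j <= m)%N then (calT m j + psi j)%N
    else 0%N
  else 0%N.

Definition calT1 (R : realType) (n j : nat) : R := (calT n j)%:R / 2 ^+ n.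

(* d_j, with the indices starting at 1, in the enumeration
   d_1 < ... < d_|D| of D. *)
Definition atom (R : realType) (D : {fset R}) (j : nat) : R :=
  nth 0 (sort <=%R (enum_fset D)) j.-1.

(* {2, ..., m - 1} *)
Definition interior_indices (m : nat) : {fset nat} :=
  [fset j in index_iota 2 m]%fset.

Definition near_log_concave (R : realType) (d : measure_display)
    (Omega : measurableType d) (P : probability Omega R)
    (D : {fset R}) (X : {RV P >-> R}) (r : nat) (I : {fset nat}) : Prop :=
  [/\ (3 <= #|` D|)%N /\ (forall w, X w \in D),
      (r <= #|` D| - 3)%N,
      (I `<=` interior_indices #|` D|)%fset,
      #|` I| = (#|` D| - r - 2)%N
    & forall j, j \in I ->
        pmf X (atom D j.-1) * pmf X (atom D j.+1) <= pmf X (atom D j) ^+ 2].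

Definition log_concave (R : realType) (d : measure_display)
    (Omega : measurableType d) (P : probability Omega R)
    (D : {fset R}) (X : {RV P >-> R}) (I : {fset nat}) : Prop :=
  near_log_concave D X 0 I.

Lemma size_history F n : size (history F n) = n.
Proof. by elim: n => //= n IHn; rewrite size_rcons IHn. Qed.

Lemma nth_history F n i : (i < n)%N -> nth 0%N (history F n) i = cov F i.
Proof.
elim: n => // n IHn; rewrite ltnS leq_eqVlt => /orP[/eqP-> //|lt_in].
by rewrite /= nth_rcons size_history lt_in IHn.
Qed.

Lemma covE F n :
    (forall f g, (forall i, (i < n)%N -> f i = g i) -> F n f = F n g) ->
  cov F n = F n (cov F).
Proof.
move=> Fext; rewrite {1}/cov /= nth_rcons size_history ltnn eqxx.
by apply: Fext => i lt_in; rewrite nth_history.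
Qed.

Lemma psi1 : psi 1 = 0%N. Proof. by []. Qed.
Lemma psi2 : psi 2 = 1%N. Proof. by []. Qed.
Lemma psi3 : psi 3 = 2%N. Proof. by []. Qed.

Lemma psi_rec j : (4 <= j)%N -> psi j = (\sum_(1 <= k < j) psi k)%N.
Proof.
case: j => [|[|[|[|j]]]] // _; rewrite {1}/psi covE // => f g fg.
by apply: eq_big_nat => k /andP[_ lt_kj]; apply: fg.
Qed.

Lemma calT_last n : calT n n.+1 = 1%N.
Proof. by case: n => [|n]; rewrite /= ?eqxx. Qed.

Lemma calT_Tdiag n : (1 <= n)%N -> calT n n = Tdiag n.
Proof. by case: n => // n _; rewrite /= [n.+1 == n.+2]ltn_eqF ?eqxx. Qed.

Lemma calT11 : calT 1 1 = 1%N. Proof. by []. Qed.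
Lemma calT22 : calT 2 2 = 2%N. Proof. by []. Qed.
Lemma calT33 : calT 3 3 = 3%N. Proof. by []. Qed.

Lemma calT_diag n : (4 <= n)%N ->
  calT n n = (\sum_(1 <= k < n.-1) calT (n - k) (n - k))%N.
Proof.
move=> n4; rewrite calT_Tdiag ?(leq_trans _ n4) //.
have -> : Tdiag n = (\sum_(1 <= k < n.-1) Tdiag (n - k))%N.
  case: n n4 => [|[|[|[|n]]]] // _; rewrite {1}/Tdiag covE // => f g fg.
  apply: eq_big_nat => k /andP[k1 _]; apply: fg.
  by rewrite ltn_subrL k1.
apply: eq_big_nat => k /andP[_ ltk]; rewrite calT_Tdiag // subn_gt0.
by rewrite (leq_trans ltk) // leq_pred.
Qed.

Lemma calT_step n j : (2 <= n)%N -> (1 <= j <= n.-1)%N ->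
  calT n j = (calT n.-1 j + psi j)%N.
Proof.
case: n => // n _ /= j1n; have /andP[_ jn] := j1n.
by rewrite [j == n.+2]ltn_eqF 1?[j == n.+1]ltn_eqF ?j1n ?ltnS ?(leqW jn).
Qed.

Lemma sorted_atoms (R : realType) (D : {fset R}) :
  sorted <%R (sort <=%R (enum_fset D)).
Proof. by rewrite sort_lt_sorted fset_uniq. Qed.

Lemma mem_atoms (R : realType) (D : {fset R}) :
  sort <=%R (enum_fset D) =i D.
Proof. by move=> x; rewrite mem_sort. Qed.

Lemma in_interior_indices m j : (j \in interior_indices m) = (1 < j < m)%N.
Proof. by rewrite !inE mem_index_iota. Qed.

(* Main.v *)
Require Import Defs.
From HB Require Import structures.
From mathcomp Require Import all_boot all_order all_algebra finmap.
From mathcomp Require Import all_classical all_reals all_analysis.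
From mathcomp Require Import zify.
Import Order.TTheory GRing.Theory Num.Theory.
Local Open Scope ring_scope.

(** The recursion [T_{n,j} = T_{n-1,j} + psi j] says that each column of the
    array is an arithmetic progression that starts on the diagonal, so
    [T_{n,j} = T_{j,j} + (n - j) psi j] ([calT_column]).  From index 4 on,
    [psi] and the diagonal are given by the sum of the preceding values (for
    the diagonal, those from [T_{2,2}] on), and such a sequence doubles at each
    step: [psi j = 3 * 2^(j-4)] and [T_{j,j} = 5 * 2^(j-4)].
    Row [n] is therefore
<<
      1, n, 2n - 3, 3n - 7, ..., 2^(j-4) (5 + 3 (n - j)), ..., 5 * 2^(n-4), 1.
>>
    For [4 < j < n] the three consecutive entries are a geometric sequence
    times an arithmetic one; the geometric factor contributes equality and the
    arithmetic one the inequality [(x - 3) (x + 3) <= x^2].  At [j = n] the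
    right neighbour is only 1, and for [j = 2], [j = 3] the inequalities
    [2n - 3 <= n^2] and [n (3n - 7) <= (2n - 3)^2] hold for every [n].  At the
    junction [j = 4] of the polynomial start with the geometric part the
    inequality fails for [n >= 5] (the row of [n = 5] has [7 * 10 > 8^2]), but
    holds for [n = 4], where the right neighbour is the final 1.

    The common factor [2^-n] does not affect log-concavity, so the statement
    on mass functions reduces to these inequalities between natural numbers. *)

(** The sum that defines [psi j.+1] consists of the one that defines [psi j]
    and the extra term [psi j]. *)
Lemma psi_double j : (4 <= j)%N -> psi j.+1 = (2 * psi j)%N.
Proof.
move=> j4; rewrite psi_rec ?(leqW j4) // big_nat_recr ?(leq_trans _ j4) //=.
by rewrite -psi_rec //; lia.
Qed.

Lemma psi_closed k : psi (k + 4) = (3 * 2 ^ k)%N.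
Proof.
elim: k => [|k IHk]; last by rewrite addSn psi_double ?leq_addl // IHk expnS; lia.
by rewrite add0n psi_rec // unlock.
Qed.

Lemma calT_diag_double n : (4 <= n)%N ->
  calT n.+1 n.+1 = (2 * calT n n)%N.
Proof.
move=> n4; rewrite calT_diag ?(leqW n4) // big_ltn; last by lia.
have -> : n.+1.-1 = n.-1.+1 by lia.
rewrite big_add1 /= subn1 /=.
(* The remaining terms are those of the recursion for row n. *)
by rewrite (eq_bigr (fun k => calT (n - k) (n - k))) // -calT_diag //; lia.
Qed.

Lemma calT_diag_closed k : calT (k + 4) (k + 4) = (5 * 2 ^ k)%N.
Proof.
elim: k => [|k IHk].
  by rewrite add0n calT_diag // unlock.
by rewrite addSn calT_diag_double ?leq_addl // IHk expnS; lia.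
Qed.

Lemma calT_column j m : (1 <= j)%N ->
  calT (m + j) j = (calT j j + m * psi j)%N.
Proof.
move=> j1; elim: m => [|m IHm]; first by rewrite addn0.
by rewrite addSn calT_step /= ?IHm; lia.
Qed.

Lemma calT_col1 n : (1 <= n)%N -> calT n 1 = 1%N.
Proof. by move=> n1; rewrite -(subnK n1) calT_column // psi1 muln0. Qed.

Lemma calT_col2 n : (2 <= n)%N -> calT n 2 = n.
Proof.
by move=> n2; rewrite -[in LHS](subnK n2) calT_column // calT22 psi2; lia.
Qed.

Lemma calT_col3 n : (3 <= n)%N -> calT n 3 = (2 * n - 3)%N.
Proof.
by move=> n3; rewrite -[in LHS](subnK n3) calT_column // calT33 psi3; lia.
Qed.

(** The index 4 is where the closed forms of [psi] and of the diagonal begin;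
    the shifts by [k] and [m] avoid truncated subtraction. *)
Lemma calT_closed k m : calT (m + (k + 4)) (k + 4) = (2 ^ k * (5 + 3 * m))%N.
Proof.
by rewrite calT_column ?addn4 // -addn4 calT_diag_closed psi_closed; lia.
Qed.

(** The geometric factors cancel, leaving [(x - 3) (x + 3) <= x^2] with
    [x = 5 + 3 (n - j)]. *)
Lemma calT_log_concave_middle n j : (5 <= j < n)%N ->
  (calT n j.-1 * calT n j.+1 <= calT n j ^ 2)%N.
Proof.
move=> /andP[j5 jn].
have [k j_eq] : exists k, j = (k + 5)%N by exists (j - 5)%N; lia.
subst j.
have [m ->] : exists m, n = (m + (k + 6))%N by exists (n - (k + 6))%N; lia.
have -> : calT (m + (k + 6)) (k + 5).-1 = (2 ^ k * (5 + 3 * m.+2))%N.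
  by rewrite -calT_closed; congr calT; lia.
have -> : calT (m + (k + 6)) (k + 5).+1 = (2 ^ k.+2 * (5 + 3 * m))%N.
  by rewrite -calT_closed; congr calT; lia.
have -> : calT (m + (k + 6)) (k + 5) = (2 ^ k.+1 * (5 + 3 * m.+1))%N.
  by rewrite -calT_closed; congr calT; lia.
rewrite !expnS expn0; set p := (2 ^ k)%N.
suff: (p * p * (4 * ((5 + 3 * m.+2) * (5 + 3 * m))) <=
       p * p * (4 * ((5 + 3 * m.+1) * (5 + 3 * m.+1))))%N by lia.
by rewrite leq_mul2l; apply/orP; right; lia.
Qed.

(** The right neighbour of the diagonal entry is the final 1 of the row. *)
Lemma calT_log_concave_diag n : (5 <= n)%N ->
  (calT n n.-1 * calT n n.+1 <= calT n n ^ 2)%N.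
Proof.
move=> n5; rewrite calT_last muln1.
have [k ->] : exists k, n = (k + 5)%N by exists (n - 5)%N; lia.
have -> : calT (k + 5) (k + 5).-1 = (2 ^ k * 8)%N.
  by rewrite -[8%N]/(5 + 3 * 1)%N -calT_closed; congr calT; lia.
have -> : calT (k + 5) (k + 5) = (5 * 2 ^ k.+1)%N.
  by rewrite -calT_diag_closed; congr calT; lia.
have := expn_gt0 2 k; rewrite !expnS expn0; set p := (2 ^ k)%N; nia.
Qed.

Lemma calT_log_concave n j : (2 <= j <= n)%N -> (n <= 4)%N || (j != 4%N) ->
  (calT n j.-1 * calT n j.+1 <= calT n j ^ 2)%N.
Proof.
move=> /andP[j2 jn] n4_or_j4.
have [j5|j4] := leqP 5 j.
  have [jn'|nj] := ltnP j n; first by rewrite calT_log_concave_middle ?j5.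
  have -> : j = n by lia.
  by rewrite calT_log_concave_diag //; lia.
have [j_eq2|j_neq2] := eqVneq j 2%N.
  subst j; rewrite /= calT_col1 ?calT_col2 //; last by lia.
  have [n3|n2] := leqP 3 n; first by rewrite calT_col3 //; nia.
  have -> : n = 2%N by lia.
  by rewrite calT_last.
have [j_eq3|j_neq3] := eqVneq j 3%N.
  subst j; rewrite /= calT_col2 ?calT_col3 //; last by lia.
  have [n4|n3] := leqP 4 n.
    by have := calT_closed 0 (n - 4); rewrite add0n subnK // => ->; nia.
  have -> : n = 3%N by lia.
  by rewrite calT_last.
(* Only j = 4 remains, and then n = 4. *)
have j_eq4 : j = 4%N by lia.
have n_eq4 : n = 4%N by move: n4_or_j4; rewrite j_eq4 eqxx orbF; lia.
by rewrite j_eq4 n_eq4 calT_last (calT_col3 4) // (calT_diag_closed 0).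
Qed.

Lemma calT1_log_concave (R : realType) n j :
  (2 <= j <= n)%N -> (n <= 4)%N || (j != 4%N) ->
  calT1 R n j.-1 * calT1 R n j.+1 <= calT1 R n j ^+ 2.
Proof.
move=> jn n4_or_j4; rewrite /calT1 expr_div_n mulf_div -expr2.
rewrite ler_pM2r ?invr_gt0 ?exprn_gt0 // -natrM -natrX ler_nat.
exact: calT_log_concave.
Qed.

Lemma card_interior_indices m : #|` interior_indices m| = (m - 2)%N.
Proof. by rewrite card_fseq undup_id ?iota_uniq // size_iota. Qed.

Theorem proposition2p25 (R : realType) (d : measure_display)
    (Omega : measurableType d) (P : probability Omega R)
    (D : nat -> {fset R}) (X : nat -> {RV P >-> R})
    (cardD : forall n : nat, (2 <= n)%N -> #|` D n| = n.+1)
    (XD : forall n : nat, (2 <= n)%N -> forall w : Omega, X n w \in D n)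
    (pmfX : forall n j : nat, (2 <= n)%N -> (1 <= j <= n.+1)%N ->
      pmf (X n) (atom (D n) j) = calT1 R n j) :
  (forall n : nat, (2 <= n <= 4)%N ->
     log_concave (D n) (X n) (interior_indices #|` D n|)) /\
  (forall n : nat, (5 <= n)%N ->
     near_log_concave (D n) (X n) 1 (interior_indices #|` D n| `\ 4%N)%fset).
Proof.
have ineq n j : (2 <= n)%N -> (2 <= j <= n)%N -> (n <= 4)%N || (j != 4%N) ->
    pmf (X n) (atom (D n) j.-1) * pmf (X n) (atom (D n) j.+1)
      <= pmf (X n) (atom (D n) j) ^+ 2.
  by move=> n2 jn n4_or_j4; rewrite !pmfX ?calT1_log_concave //; lia.
split=> n.
  move=> /andP[n2 n4]; rewrite /log_concave /near_log_concave cardD //.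
  split=> //; first by split=> // w; exact: XD.
    by rewrite card_interior_indices subn0.
  by move=> j; rewrite in_interior_indices => jn; apply: ineq; rewrite ?n4.
move=> n5; have n2 : (2 <= n)%N by lia.
rewrite /near_log_concave cardD //; split.
- by split=> // w; exact: XD.
- by lia.
- exact: fsubD1set.
- have := cardfsD1 4%N (interior_indices n.+1).
  rewrite in_interior_indices card_interior_indices (_ : (1 < 4 < n.+1)%N); last by lia.
  by move=> /= ?; lia.
- move=> j; rewrite in_fsetD1 in_interior_indices => /andP[j4 jn].
  by apply: ineq; rewrite ?j4 ?orbT.
Qed.
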